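(* Let $L\in(0,\infty)$, $\mu\in(-\infty,L)$, let $f\in\mathcal{F}_{\mu,L}(\mathbb{R}^n)$ have a non-empty set of global minimizers $X^\star$, let $x^1\in\mathbb{R}^n$ and let $X=\{x: f(x)\le f(x^1)\}$. Then: (i) If $f$ satisfies the Polyak-Łojasiewicz inequality on $X$ with constant $\mu_p>0$, then $f$ has a quadratic functional growth on $X$ with $\mu_q=\mu_p$. (ii) If $f$ has a quadratic functional growth on $X$ with constant $\mu_q>0$ and $\mu_q>\tfrac{-\mu L}{L-\mu}$, then $f$ has a quadratic gradient growth on $X$ with $\mu_g=\tfrac{\mu_q}{2}\left(1-\tfrac{\mu}{L}\right)+\tfrac{\mu}{2}$. (iii) If for every $x\in X$ there is some $x^\star\in\Pi_{X^\star}(x)$ with $$f(x)-f(x^\star)\le\langle\nabla f(x),x-x^\star\rangle,$$ and $f$ has a quadratic functional growth on $X$ with constant $\mu_q>0$, then $f$ has a quadratic gradient growth on $X$ with $\mu_g=\tfrac{\mu_q}{2}$.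
   Context: $\|\cdot\|$, $\langle\cdot,\cdot\rangle$ are the Euclidean norm and inner product, $f^\star=\inf_{x\in\mathbb{R}^n}f(x)$. $\mathcal{F}_{\mu,L}(\mathbb{R}^n)$ denotes the set of differentiable functions $f:\mathbb{R}^n\to\mathbb{R}$ such that both $\tfrac{L}{2}\|\cdot\|^2-f$ and $f-\tfrac{\mu}{2}\|\cdot\|^2$ are convex. $d_{X^\star}(x)=\inf_{y\in X^\star}\|y-x\|$ and $\Pi_{X^\star}(x)=\{y\in X^\star:\|y-x\|=d_{X^\star}(x)\}$. Polyak-Łojasiewicz (PŁ) inequality on $X$ with constant $\mu_p>0$: $f(x)-f^\star\le\tfrac{1}{2\mu_p}\|\nabla f(x)\|^2$ for all $x\in X$. Quadratic functional growth on $X$ with constant $\mu_q>0$: $\tfrac{\mu_q}{2}d_{X^\star}^2(x)\le f(x)-f^\star$ for all $x\in X$. Quadratic gradient growth on $X$ with constant $\mu_g>0$: for every $x\in X$, $\langle\nabla f(x),x-x^\star\rangle\ge\mu_g\, d_{X^\star}^2(x)$ for some $x^\star\in\Pi_{X^\star}(x)$. *)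

(* Defs.v *)
From HB Require Import structures.
From mathcomp Require Import all_boot all_order all_algebra.
From mathcomp Require Import all_classical all_reals all_analysis.

Set Implicit Arguments.
Unset Strict Implicit.
Unset Printing Implicit Defensive.

Import Order.TTheory GRing.Theory Num.Theory.
Import numFieldNormedType.Exports.

Local Open Scope classical_set_scope.
Local Open Scope ring_scope.

Definition dotv (R : realType) (n : nat) (u v : 'rV[R]_n) : R :=
  \sum_(i < n) u 0 i * v 0 i.

(* The canonical norm [`|x|] on ['rV[R]_n] is the sup norm, hence a separate
   Euclidean norm; both induce the same topology, so the library's
   [differentiable] is the usual notion. *)
Definition enorm (R : realType) (n : nat) (x : 'rV[R]_n) : R :=
  Num.sqrt (dotv x x).

Definition gradient (R : realType) (n : nat) (f : 'rV[R]_n -> R)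
    (x : 'rV[R]_n) : 'rV[R]_n :=
  \row_(i < n) 'D_(delta_mx 0 i) f x.

(* The class F_{mu,L}(R^n); [mu] may be negative. *)
Definition smooth_class (R : realType) (n : nat) (mu L : R)
    (f : 'rV[R]_n -> R) : Prop :=
  [/\ forall x, differentiable f x,
      convex_function setT (fun x : 'rV[R]_n => L / 2 * enorm x ^+ 2 - f x) &
      convex_function setT (fun x : 'rV[R]_n => f x - mu / 2 * enorm x ^+ 2)].

(* [inf] is the real infimum: it is the infimum of [f] only when [f] is bounded
   below, in particular when [minimizers f] is nonempty. *)
Definition inf_value (R : realType) (n : nat) (f : 'rV[R]_n -> R) : R :=
  inf (range f).

Definition minimizers (R : realType) (n : nat) (f : 'rV[R]_n -> R) :
    set 'rV[R]_n :=
  [set x | forall y, f x <= f y].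

Definition edist (R : realType) (n : nat) (A : set 'rV[R]_n)
    (x : 'rV[R]_n) : R :=
  inf [set enorm (y - x) | y in A].

Definition eproj (R : realType) (n : nat) (A : set 'rV[R]_n)
    (x : 'rV[R]_n) : set 'rV[R]_n :=
  [set y | A y /\ enorm (y - x) = edist A x].

(* Positivity of the constant is part of each of the next three properties. *)
Definition PL_inequality (R : realType) (n : nat) (f : 'rV[R]_n -> R)
    (X : set 'rV[R]_n) (mup : R) : Prop :=
  0 < mup /\
  forall x, X x ->
    f x - inf_value f <= (2 * mup)^-1 * enorm (gradient f x) ^+ 2.

Definition quadratic_functional_growth (R : realType) (n : nat)
    (f : 'rV[R]_n -> R) (X : set 'rV[R]_n) (muq : R) : Prop :=
  0 < muq /\
  forall x, X x ->
    muq / 2 * edist (minimizers f) x ^+ 2 <= f x - inf_value f.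

Definition quadratic_gradient_growth (R : realType) (n : nat)
    (f : 'rV[R]_n -> R) (X : set 'rV[R]_n) (mug : R) : Prop :=
  0 < mug /\
  forall x, X x ->
    exists2 xs, eproj (minimizers f) x xs &
      mug * edist (minimizers f) x ^+ 2 <= dotv (gradient f x) (x - xs).

(* Main.v *)
Require Import Defs.
From HB Require Import structures.
From mathcomp Require Import all_boot all_order all_algebra.
From mathcomp Require Import all_classical all_reals all_analysis.
From mathcomp Require Import ring lra.

Import Order.TTheory GRing.Theory Num.Theory.
Import numFieldNormedType.Exports.

Local Open Scope classical_set_scope.
Local Open Scope ring_scope.

(* (i) Write m for the minimum of f.  For k < mup / 2, minimize
   sqrt (f - m) + sqrt k |. - x| (Ekeland's argument; coercivity gives a
   minimizer y, and f y <= f x).  If y is not a minimizer of f, a small step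
   along - grad f y yields |grad f y|^2 <= 4 k (f y - m) < 2 mup (f y - m),
   against the PL inequality.  So y is a minimizer of f and
   sqrt k d(x) <= sqrt k |y - x| <= sqrt (f x - m); then let k tend to mup / 2.

   (ii) Let xs be a projection of x and z = (L xs - mu x) / (L - mu).  Comparing
   f z >= f x + <grad f x, z - x> + mu/2 |z - x|^2 with
   f z <= f xs + L/2 |z - xs|^2 gives
   <grad f x, x - xs> >= (1 - mu/L) (f x - f xs) + mu/2 |x - xs|^2,
   into which the functional growth is inserted. *)

(** * Euclidean inner product and norm *)

Lemma dotvC {R : realType} {n : nat} (u v : 'rV[R]_n) : dotv u v = dotv v u.
Proof. by apply: eq_bigr => i _; rewrite mulrC. Qed.

Lemma dotvDl {R : realType} {n : nat} (u v w : 'rV[R]_n) :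
  dotv (u + v) w = dotv u w + dotv v w.
Proof. by rewrite -big_split; apply: eq_bigr => i _; rewrite mxE mulrDl. Qed.

Lemma dotvZl {R : realType} {n : nat} (a : R) (u v : 'rV[R]_n) :
  dotv (a *: u) v = a * dotv u v.
Proof.
by rewrite /dotv mulr_sumr; apply: eq_bigr => i _; rewrite mxE mulrA.
Qed.

Lemma dotvDr {R : realType} {n : nat} (u v w : 'rV[R]_n) :
  dotv u (v + w) = dotv u v + dotv u w.
Proof. by rewrite dotvC dotvDl !(dotvC u). Qed.

Lemma dotvZr {R : realType} {n : nat} (a : R) (u v : 'rV[R]_n) :
  dotv u (a *: v) = a * dotv u v.
Proof. by rewrite dotvC dotvZl dotvC. Qed.

Lemma dotvNl {R : realType} {n : nat} (u v : 'rV[R]_n) :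
  dotv (- u) v = - dotv u v.
Proof. by rewrite -scaleN1r dotvZl mulN1r. Qed.

Lemma dotvNr {R : realType} {n : nat} (u v : 'rV[R]_n) :
  dotv u (- v) = - dotv u v.
Proof. by rewrite dotvC dotvNl dotvC. Qed.

Definition dotvE {R : realType} {n : nat} :=
  (@dotvDl R n, @dotvDr R n, @dotvNl R n, @dotvNr R n,
   @dotvZl R n, @dotvZr R n).

Lemma dotv_ge0 {R : realType} {n : nat} (u : 'rV[R]_n) : 0 <= dotv u u.
Proof. by apply: sumr_ge0 => i _; rewrite -expr2 sqr_ge0. Qed.

Lemma enorm_ge0 {R : realType} {n : nat} (u : 'rV[R]_n) : 0 <= enorm u.
Proof. exact: sqrtr_ge0. Qed.

Lemma sqr_enorm {R : realType} {n : nat} (u : 'rV[R]_n) :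
  enorm u ^+ 2 = dotv u u.
Proof. by rewrite sqr_sqrtr ?dotv_ge0. Qed.

Lemma enormN {R : realType} {n : nat} (u : 'rV[R]_n) : enorm (- u) = enorm u.
Proof. by rewrite /enorm !dotvE opprK. Qed.

Lemma enormZ {R : realType} {n : nat} (a : R) (u : 'rV[R]_n) :
  enorm (a *: u) = `|a| * enorm u.
Proof.
by rewrite /enorm !dotvE mulrA -expr2 sqrtrM ?sqr_ge0// sqrtr_sqr.
Qed.

Lemma coord_le_enorm {R : realType} {n : nat} (u : 'rV[R]_n) (i : 'I_n) :
  `|u 0 i| <= enorm u.
Proof.
rewrite -ler_sqr ?nnegrE ?enorm_ge0// sqr_enorm real_normK ?num_real//.
rewrite /dotv (bigD1 i)//= -expr2 lerDl sumr_ge0// => j _.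
by rewrite -expr2 sqr_ge0.
Qed.

Lemma dotv_le_enorm {R : realType} {n : nat} (u v : 'rV[R]_n) :
  dotv u v <= enorm u * enorm v.
Proof.
have [v0|v0] := eqVneq (dotv v v) 0.
  have z i : v 0 i = 0.
    apply/eqP; rewrite -normr_eq0 eq_le normr_ge0 andbT.
    by rewrite (le_trans (coord_le_enorm _ _))// /enorm v0 sqrtr0.
  by rewrite /dotv big1 ?mulr_ge0 ?enorm_ge0// => i _; rewrite z mulr0.
have vp : 0 < dotv v v by rewrite lt_neqAle eq_sym v0 dotv_ge0.
(* [dotv v v] times the component of [u] orthogonal to [v]; its squared norm is [dotv v v * (dotv u
   u * dotv v v - dotv u v ^+ 2)]. *)
have := dotv_ge0 (dotv v v *: u - dotv u v *: v).
rewrite !dotvE (dotvC v u) => h.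
have h2 : dotv u v ^+ 2 <= dotv u u * dotv v v.
  by rewrite -subr_ge0 -(pmulr_rge0 _ vp); apply: le_trans h _; lra.
rewrite (le_trans (ler_norm _))// -ler_sqr ?nnegrE ?mulr_ge0 ?enorm_ge0//.
by rewrite real_normK ?num_real// exprMn !sqr_enorm.
Qed.

Lemma enormD {R : realType} {n : nat} (u v : 'rV[R]_n) :
  enorm (u + v) <= enorm u + enorm v.
Proof.
rewrite -ler_sqr ?nnegrE ?addr_ge0 ?enorm_ge0// sqrrD !sqr_enorm !dotvE.
rewrite (dotvC v u); have := dotv_le_enorm u v; lra.
Qed.

(** * Continuity and attained minima *)

Lemma continuous_enorm {R : realType} {n : nat} (a : 'rV[R]_n) :
  continuous (fun x : 'rV[R]_n => enorm (x - a)).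
Proof.
have h (i : 'I_n) : true ->
    continuous (fun y : 'rV[R]_n => (y - a) 0 i * (y - a) 0 i).
  move=> _ x.
  have h : {for x, continuous (fun y : 'rV[R]_n => (y - a) 0 i)}.
    apply: (@continuous_comp _ _ _ (fun y : 'rV[R]_n => y - a)
      (fun M : 'rV[R]_n => M 0 i)); last exact: coord_continuous.
    exact: (cvgB (@cvg_id _ _) (cvg_cst _)).
  exact: (cvgM h h).
have {}h : continuous (fun y : 'rV[R]_n => dotv (y - a) (y - a)).
  exact: (@continuous_big _ _ +%R 0 xpredT (@add_continuous _) _
    (index_enum _) _ h).
move=> x.
change {for x, continuous (Num.sqrt \o (fun y => dotv (y - a) (y - a)))}.
by apply: continuous_comp; [exact: h|exact: sqrt_continuous].
Qed.

(** The linear lower bound confines the sublevel set through a point [a] of [A] to a box of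
    half-width [psi a / c] around [x], so the extreme value theorem applies there. It serves both
    for projections and for the Ekeland argument. *)
Lemma coercive_min {R : realType} {n : nat} {A : set 'rV[R]_n} (x : 'rV[R]_n)
    {c : R} {psi : 'rV[R]_n -> R} :
  closed A -> A !=set0 -> continuous psi -> 0 < c ->
  (forall y, c * enorm (y - x) <= psi y) ->
  exists2 y, A y & forall z, A z -> psi y <= psi z.
Proof.
move=> clA [a Aa] cpsi c0 coer.
pose K := A `&` [set y | psi y <= psi a].
have cptK : compact K.
  pose r := psi a / c.
  apply: (@subclosed_compact _ _ [set v : 'rV[R]_n | forall i,
      [set` `[x 0 i - r, x 0 i + r]] (v 0 i)]).
  - apply: closedI => //.
    exact: ((continuous_closedP psi).1 cpsi _ (@closed_le _ (psi a))).
  - apply: (@rV_compact R n (fun i => [set` `[x 0 i - r, x 0 i + r]])) => i.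
    exact: segment_compact.
  - move=> y [_ /= ya] i; rewrite /= in_itv/=.
    have : `|(y - x) 0 i| <= r.
      rewrite (le_trans (coord_le_enorm _ _))// ler_pdivlMr// mulrC.
      exact: le_trans (coer y) ya.
    by rewrite !mxE ler_norml; lra.
have K0 : K !=set0 by exists a; split => //=.
have [y] := compact_EVT_min K0 cptK (continuous_subspaceT cpsi).
rewrite inE => -[Ay ya] ymin; exists y => // z Az.
have [za|/ltW za] := leP (psi z) (psi a); first by apply: ymin; rewrite inE.
exact: le_trans ya za.
Qed.

(** * Directional derivatives and the quadratic bounds of the class *)

Lemma derive_dotv_gradient {R : realType} {n : nat} (f : 'rV[R]_n -> R)
    (x v : 'rV[R]_n) : differentiable f x -> 'D_v f x = dotv (gradient f x) v.
Proof.
move=> df; rewrite deriveE// [in LHS](row_sum_delta v) linear_sum.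
by apply: eq_bigr => i _; rewrite linearZ/= mxE deriveE// mulrC.
Qed.

(** Convexity on the segment, combined with the identity [|x + t v|^2 = (1 - t) |x|^2 + t |x + v|^2
    - t (1 - t) |v|^2]. *)
Lemma strongly_convex_line {R : realType} {n : nat} (k : R)
    (f : 'rV[R]_n -> R) (x v : 'rV[R]_n) (t : R) :
  convex_function setT (fun x : 'rV[R]_n => f x - k / 2 * enorm x ^+ 2) ->
  0 <= t -> t <= 1 ->
  f (x + t *: v) <= (1 - t) * f x + t * f (x + v)
                    - k / 2 * (t * (1 - t)) * enorm v ^+ 2.
Proof.
move=> fc t0 t1.
have := fc (Itv01 t0 t1) (x + v) x; rewrite !inE => /(_ Logic.I Logic.I).
rewrite convRE /=.
have -> : conv (Itv01 t0 t1) (x + v : convex_lmodType _) x = x + t *: v.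
  by apply/rowP => i; rewrite /conv/= !mxE /unstable.onem; ring.
rewrite /unstable.onem !sqr_enorm !dotvE (dotvC v x); lra.
Qed.

(** Divide the segment bound by [t] and let [t] tend to 0 from the right. As [k] may have any sign,
    this gives both quadratic bounds of the class. *)
Lemma strongly_convex_derive {R : realType} {n : nat} (k : R)
    (f : 'rV[R]_n -> R) (x v : 'rV[R]_n) :
  convex_function setT (fun x : 'rV[R]_n => f x - k / 2 * enorm x ^+ 2) ->
  differentiable f x ->
  f x + 'D_v f x + k / 2 * enorm v ^+ 2 <= f (x + v).
Proof.
move=> fc df.
have h1 :
  h^-1 *: ((f \o shift x) (h *: v) - f x) + k / 2 * (1 - h) * enorm v ^+ 2
   @[h --> 0^'+] --> 'D_v f x + k / 2 * (1 - 0) * enorm v ^+ 2.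
  apply: cvg_dnbhs_at_right; apply: cvgD; first exact: diff_derivable.
  apply: cvgMl; apply: cvgMr; apply: cvgB; first exact: cvg_cst.
  exact: nbhs_dnbhs.
suff : 'D_v f x + k / 2 * (1 - 0) * enorm v ^+ 2 <= f (x + v) - f x by lra.
apply: (cvgr_to_le h1); near=> h.
have h0 : 0 < h by [].
have hl1 : h <= 1 by near: h; exact: nbhs_right_le.
have := @strongly_convex_line _ _ _ _ x v h fc (ltW h0) hl1.
rewrite /= [h *: v + x]addrC => H.
have -> : k / 2 * (1 - h) * enorm v ^+ 2 =
  h^-1 *: (k / 2 * (h * (1 - h)) * enorm v ^+ 2).
  by rewrite /GRing.scale/=; field; rewrite gt_eqF.
rewrite -scalerDr /GRing.scale/= mulrC ler_pdivrMr//; lra.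
Unshelve. all: by end_near. Qed.

Lemma smooth_class_lower {R : realType} {n : nat} {mu L : R}
    {f : 'rV[R]_n -> R} (x v : 'rV[R]_n) :
  smooth_class mu L f ->
  f x + dotv (gradient f x) v + mu / 2 * enorm v ^+ 2 <= f (x + v).
Proof.
case=> df _ cf; rewrite -derive_dotv_gradient//.
exact: strongly_convex_derive.
Qed.

Lemma smooth_class_upper {R : realType} {n : nat} {mu L : R}
    {f : 'rV[R]_n -> R} (x v : 'rV[R]_n) :
  smooth_class mu L f ->
  f (x + v) <= f x + dotv (gradient f x) v + L / 2 * enorm v ^+ 2.
Proof.
case=> df cf _; rewrite -derive_dotv_gradient//.
(* The upper bound for [f] is the lower bound for [- f] with modulus [- L]. *)
have /strongly_convex_derive : convex_function setT
    (fun x : 'rV[R]_n => (- f) x - - L / 2 * enorm x ^+ 2).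
  have -> // : (fun x : 'rV[R]_n => (- f) x - - L / 2 * enorm x ^+ 2) =
    (fun x : 'rV[R]_n => L / 2 * enorm x ^+ 2 - f x).
  by apply: funext => y; rewrite [(- f) y]/(- f y) !mulNr opprK addrC.
move=> /(_ x v (differentiableN (df x))).
rewrite deriveN; last exact: diff_derivable.
have fN y : (- f) y = - f y by [].
rewrite !fN; move: ('D_v f x) (enorm v ^+ 2) (f x) (f (x + v)) => a b c d; lra.
Qed.

(** * Minimizers and projections onto their set *)

Lemma gradient_minimizer {R : realType} {n : nat} {mu L : R}
    {f : 'rV[R]_n -> R} {x : 'rV[R]_n} :
  0 < L -> smooth_class mu L f -> minimizers f x ->
  dotv (gradient f x) (gradient f x) = 0.
Proof.
move=> L0 sf mx; apply/eqP; rewrite eq_le dotv_ge0 andbT.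
set g := gradient f x.
(* A gradient step of length [L^-1] lowers [f] by at least [|g|^2 / (2 L)], which a minimizer
   forbids unless [g] vanishes. *)
have := le_trans (mx _) (smooth_class_upper x (- L^-1 *: g) sf).
rewrite sqr_enorm !dotvE -/g.
have -> : f x + - L^-1 * dotv g g + L / 2 * (- L^-1 * (- L^-1 * dotv g g)) =
  f x - (2 * L)^-1 * dotv g g by field; rewrite gt_eqF.
rewrite lerDl oppr_ge0 pmulr_rle0// invr_gt0; lra.
Qed.

Lemma minimizer_upper {R : realType} {n : nat} {mu L : R}
    {f : 'rV[R]_n -> R} {x : 'rV[R]_n} (v : 'rV[R]_n) :
  0 < L -> smooth_class mu L f -> minimizers f x ->
  f (x + v) <= f x + L / 2 * enorm v ^+ 2.
Proof.
move=> L0 sf mx; have := smooth_class_upper x v sf.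
suff -> : dotv (gradient f x) v = 0 by rewrite addr0.
have g0 := gradient_minimizer L0 sf mx.
apply: big1 => i _; suff -> : gradient f x 0 i = 0 by rewrite mul0r.
apply/eqP; rewrite -normr_eq0 eq_le normr_ge0 andbT.
by rewrite (le_trans (coord_le_enorm _ _))// /enorm g0 sqrtr0.
Qed.

Lemma inf_value_minimizer {R : realType} {n : nat} {f : 'rV[R]_n -> R}
    {x : 'rV[R]_n} : minimizers f x -> inf_value f = f x.
Proof.
move=> mx; apply/eqP; rewrite eq_le; apply/andP; split.
  by apply: ge_inf; [exists (f x) => _ [y _ <-]; exact: mx|exists x].
by apply: lb_le_inf; [exists (f x); exists x|move=> _ [y _ <-]; exact: mx].
Qed.

Lemma closed_minimizers {R : realType} {n : nat} {f : 'rV[R]_n -> R} :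
  continuous f -> closed (minimizers f).
Proof.
move=> cf.
have -> : minimizers f = \bigcap_y (f @^-1` [set r | r <= f y]).
  by apply/seteqP; split => x mx y => [_|]; exact: mx.
apply: closed_bigI => y _.
exact: ((continuous_closedP f).1 cf _ (@closed_le _ (f y))).
Qed.

Lemma edist_le_enorm {R : realType} {n : nat} (A : set 'rV[R]_n)
    (x y : 'rV[R]_n) :
  A y -> Defs.edist A x <= enorm (y - x).
Proof.
move=> Ay; apply: ge_inf; last by exists y.
by exists 0 => _ [z _ <-]; exact: enorm_ge0.
Qed.

Lemma eproj_neq0 {R : realType} {n : nat} {A : set 'rV[R]_n} (x : 'rV[R]_n) :
  closed A -> A !=set0 -> eproj A x !=set0.
Proof.
move=> clA A0.
have [y|y Ay ymin] := coercive_min x clA A0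
  (continuous_enorm x) ltr01; first by rewrite mul1r.
exists y; split => //; apply/eqP; rewrite eq_le edist_le_enorm// andbT.
apply: lb_le_inf; first by exists (enorm (y - x)); exists y.
by move=> _ [z Az <-]; exact: ymin.
Qed.

(* The point where the two bounds are compared extremizes their difference on
   the line through [x] and [xs]. *)
Lemma gradient_growth_at_minimizer {R : realType} {n : nat} {mu L : R}
    {f : 'rV[R]_n -> R} {x xs : 'rV[R]_n} :
  0 < L -> mu < L -> smooth_class mu L f -> minimizers f xs ->
  (1 - mu / L) * (f x - f xs) + mu / 2 * enorm (xs - x) ^+ 2
    <= dotv (gradient f x) (x - xs).
Proof.
move=> L0 muL sf mxs.
have Lmu : 0 < L - mu by lra.
have low := smooth_class_lower x (L / (L - mu) *: (xs - x)) sf.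
have := minimizer_upper (mu / (L - mu) *: (xs - x)) L0 sf mxs.
have <- : x + L / (L - mu) *: (xs - x) = xs + mu / (L - mu) *: (xs - x).
  rewrite -[L in L / _](subrK mu) mulrDl divff ?gt_eqF// scalerDl scale1r.
  by rewrite addrA [x + _]addrC subrK.
move=> /(le_trans low); rewrite !enormZ !exprMn !real_normK ?num_real//.
rewrite dotvZr -(opprB xs x) dotvNr.
set d := dotv _ _; set e := enorm _ ^+ 2 => H.
(* This factor brings the coefficient of [d], which is [L / (L - mu)], to 1; the two terms in [e]
   then combine to [mu / 2 * e]. *)
have k0 : 0 <= (L - mu) / L by rewrite divr_ge0// ltW.
have := ler_wpM2l k0 H.
have -> : 1 - mu / L = (L - mu) / L by field; rewrite gt_eqF.
rewrite -subr_ge0 => H2; rewrite -subr_ge0; apply: le_trans H2 _.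
rewrite le_eqVlt; apply/orP; left; apply/eqP; field.
by rewrite !gt_eqF.
Qed.

(** Off the minimizers, PL makes the slope of [sqrt (f - f xs)] at least [sqrt (mup / 2)]. With [k]
    strictly smaller, a penalty of slope [sqrt k] cannot stop the descent before a minimizer is
    reached. *)
Lemma PL_quadratic_growth_lt {R : realType} {n : nat} {mu L : R}
    {f : 'rV[R]_n -> R} {x xs : 'rV[R]_n} {k mup : R} :
  0 < L -> smooth_class mu L f -> minimizers f xs -> 0 < k -> k < mup / 2 ->
  (forall y, f y <= f x ->
     f y - f xs <= (2 * mup)^-1 * enorm (gradient f y) ^+ 2) ->
  k * Defs.edist (minimizers f) x ^+ 2 <= f x - f xs.
Proof.
move=> L0 sf mxs k0 kmup pl.
pose phi y := Num.sqrt (f y - f xs).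
have phi0 y : 0 <= phi y by exact: sqrtr_ge0.
have phi2 y : phi y ^+ 2 = f y - f xs.
  by rewrite sqr_sqrtr// subr_ge0; exact: mxs.
pose c := Num.sqrt k.
have c0 : 0 < c by rewrite sqrtr_gt0.
have c2 : c ^+ 2 = k by rewrite sqr_sqrtr// ltW.
have edist0 : 0 <= Defs.edist (minimizers f) x.
  apply: lb_le_inf; first by exists (enorm (xs - x)); exists xs.
  by move=> _ [y _ <-]; exact: enorm_ge0.
suff main : c * Defs.edist (minimizers f) x <= phi x.
  by rewrite -c2 -exprMn -phi2 ler_sqr ?nnegrE ?mulr_ge0// ltW.
have cf : continuous f.
  by move=> y; apply: differentiable_continuous; case: sf.
have cphi : continuous phi.
  move=> y; apply: (@continuous_comp _ _ _ (fun y => f y - f xs) Num.sqrt).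
    exact: (cvgB (cf y) (cvg_cst _)).
  exact: sqrt_continuous.
have cpsi : continuous (fun y => phi y + c * enorm (y - x)).
  move=> y; apply: (cvgD (cphi y)).
  exact: (cvgM (cvg_cst c) (continuous_enorm x y)).
have [|y _ ymin] := coercive_min x closedT (ex_intro _ x Logic.I) cpsi c0.
  by move=> y; rewrite lerDr.
have yx : phi y + c * enorm (y - x) <= phi x.
  have := ymin x Logic.I.
  by rewrite subrr -(scale0r 0) enormZ normr0 mul0r mulr0 addr0.
have [my|nmy] := pselect (minimizers f y).
  apply: le_trans yx; apply: ler_wpDl => //.
  by rewrite ler_pM2l//; exact: edist_le_enorm.
exfalso.
have fyx : f y <= f x.
  rewrite -(lerD2r (- f xs)) -!phi2 ler_sqr ?nnegrE//.
  by apply: le_trans yx; rewrite lerDl mulr_ge0 ?enorm_ge0// ltW.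
have a0 : 0 < phi y.
  rewrite sqrtr_gt0 subr_gt0 lt_neqAle mxs andbT; apply/eqP => e.
  by apply: nmy => z; rewrite -e; exact: mxs.
have := pl y fyx; rewrite -phi2.
set a := phi y in a0 *; set g := gradient f y; set G := enorm g => plG.
have mup0 : 0 < mup by lra.
(* PL gives [G^2 >= 2 mup a^2], which exceeds [4 k a^2] because [k < mup / 2]. *)
have aG : 2 * c * a < G.
  rewrite -ltr_sqr ?nnegrE ?enorm_ge0 ?mulr_ge0 ?(ltW c0) ?(ltW a0)//.
  rewrite !exprMn c2.
  have : 2 * mup * a ^+ 2 <= G ^+ 2.
    by rewrite -ler_pdivlMl// mulr_gt0.
  apply: lt_le_trans; rewrite ltr_pM2r ?exprn_gt0//; lra.
have G0 : 0 < G by apply: le_lt_trans aG; rewrite !mulr_ge0// ltW.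
(* The first bound keeps the second-order term below the gain [G - 2 c a]; the second makes
   [a - t c G] nonnegative, so that it can be squared. *)
pose t := Num.min ((G - 2 * c * a) / (L * G)) (a / (c * G)).
have t0 : 0 < t by rewrite lt_min !divr_gt0 ?mulr_gt0// subr_gt0.
have t1 : t * (L * G) <= G - 2 * c * a.
  by rewrite -ler_pdivlMr ?mulr_gt0// ge_min lexx.
have t2 : t * (c * G) <= a.
  by rewrite -ler_pdivlMr ?mulr_gt0// ge_min lexx orbT.
(* Minimality of [y] and the triangle inequality: [phi] drops by at most [c] times the step length
   [t G]. *)
have phit : a - t * (c * G) <= phi (y - t *: g).
  have := ymin (y - t *: g) Logic.I.
  have := enormD (y - x) (- (t *: g)).
  rewrite enormN enormZ gtr0_norm// -/G [y - x + _]addrAC => tri.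
  have := ler_wpM2l (ltW c0) tri; rewrite -/a; lra.
have phit2 : (a - t * (c * G)) ^+ 2 <= f (y - t *: g) - f xs.
  by rewrite -phi2 ler_sqr ?nnegrE// subr_ge0.
have := smooth_class_upper y (- (t *: g)) sf.
rewrite enormN enormZ gtr0_norm// -/G dotvNr dotvZr -/g -sqr_enorm -/G => up.
have ya : f y - f xs = a ^+ 2 by rewrite -phi2.
(* Compare [phit2] with [up], cancel [a^2] and discard the square [(t c G)^2]. But [t1] makes the
   last factor at least half of [G - 2 c a], hence positive. *)
have k1 : t * G * (G - 2 * c * a - L / 2 * t * G) <= 0.
  have : 0 <= (t * (c * G)) ^+ 2 by rewrite sqr_ge0.
  rewrite exprMn in up; lra.
have : 0 < t * G * (G - 2 * c * a - L / 2 * t * G).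
  by rewrite !mulr_gt0//; lra.
lra.
Qed.

Theorem theorem6 (R : realType) (n : nat) (L mu : R) (f : 'rV[R]_n -> R)
    (x1 : 'rV[R]_n) (X : set 'rV[R]_n) :
  0 < L -> mu < L ->
  smooth_class mu L f ->
  minimizers f !=set0 ->
  X = [set x | f x <= f x1] ->
  [/\ forall mup : R,
        PL_inequality f X mup -> quadratic_functional_growth f X mup,
      forall muq : R,
        quadratic_functional_growth f X muq ->
        - mu * L / (L - mu) < muq ->
        quadratic_gradient_growth f X (muq / 2 * (1 - mu / L) + mu / 2) &
      forall muq : R,
        (forall x, X x ->
           exists2 xs, eproj (minimizers f) x xs &
             f x - f xs <= dotv (gradient f x) (x - xs)) ->
        quadratic_functional_growth f X muq ->
        quadratic_gradient_growth f X (muq / 2)].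
Proof.
move=> L0 muL sf [xs mxs] ->.
have cf : continuous f.
  by move=> y; apply: differentiable_continuous; case: sf.
have infE := inf_value_minimizer mxs.
split.
- move=> mup [mup0 pl]; split => // x /= fx.
  rewrite infE; rewrite infE in pl.
  apply/ler_addgt0Pl => e e0.
  pose d2 := Defs.edist (minimizers f) x ^+ 2.
  have d20 : 0 <= d2 by exact: sqr_ge0.
  (* The limit in [k], up to an error [e]: the first argument of the minimum costs at most [e] after
     multiplication by [d2], with [+ 1] guarding against [d2 = 0]; the second keeps [k] positive. *)
  pose k := mup / 2 - Num.min (e / (d2 + 1)) (mup / 4).
  have m0 : 0 < Num.min (e / (d2 + 1)) (mup / 4).
    by rewrite lt_min !divr_gt0//; lra.
  have m1 : Num.min (e / (d2 + 1)) (mup / 4) <= mup / 4.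
    by rewrite ge_min lexx orbT.
  have m2 : Num.min (e / (d2 + 1)) (mup / 4) * (d2 + 1) <= e.
    by rewrite -ler_pdivlMr ?ge_min ?lexx//; lra.
  have := @PL_quadratic_growth_lt _ _ _ _ _ x _ k mup L0 sf mxs.
  have k0 : 0 < k by rewrite /k; lra.
  have km : k < mup / 2 by rewrite /k; lra.
  (* PL on [X] suffices, since [f y <= f x] keeps [y] in the sublevel set. *)
  move=> /(_ k0 km (fun y yx => pl y (le_trans yx fx))).
  by rewrite /k -/d2; lra.
- move=> muq [muq0 qf] muqL; split.
    have Lmu : 0 < L - mu by lra.
    move: muqL; rewrite ltr_pdivrMr// => H.
    (* The threshold on [muq] says exactly that the second factor is positive. *)
    have -> : muq / 2 * (1 - mu / L) + mu / 2 =
        (2 * L)^-1 * (muq * (L - mu) + mu * L).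
      by field; rewrite gt_eqF.
    by rewrite mulr_gt0 ?invr_gt0//; lra.
  move=> x /qf; rewrite infE => H.
  have [p [mp pE]] := eproj_neq0 x (closed_minimizers cf) (ex_intro _ xs mxs).
  exists p => //.
  have := gradient_growth_at_minimizer (x := x) L0 muL sf mp.
  rewrite pE => /(le_trans _); apply.
  have fE : f p = f xs by apply/eqP; rewrite eq_le mp mxs.
  (* The functional growth is multiplied by [1 - mu / L], nonnegative since [mu < L]. *)
  rewrite fE mulrDl lerD2r mulrAC [leRHS]mulrC ler_wpM2r//.
  by rewrite subr_ge0 ler_pdivrMr// mul1r ltW.
- move=> muq proj [muq0 qf]; split; first by rewrite divr_gt0.
  move=> x Xx; have [p [mp pE] H] := proj x Xx; exists p => //.
  have := qf x Xx; rewrite (inf_value_minimizer mp) => /le_trans; exact.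
Qed.
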